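(* The following six mesh patterns $(12,R)$ are pairwise equidistributed, where $R$ ranges over: $\{(1,2),(2,2),(0,1),(1,1)\}$, $\{(1,2),(0,1),(1,1),(0,0)\}$, $\{(2,2),(1,1),(2,1),(1,0)\}$, $\{(1,1),(2,1),(0,0),(1,0)\}$, $\{(2,2),(0,1),(2,1),(0,0)\}$, $\{(1,2),(2,2),(0,0),(1,0)\}$.
   Context: For $R\subseteq\{0,1,2\}^2$ and $\pi=\pi_1\cdots\pi_n\in S_n$, an occurrence of the mesh pattern $(12,R)$ in $\pi$ is a pair of positions $i_1<i_2$ with $\pi_{i_1}<\pi_{i_2}$ such that, setting $x_0=0,x_1=i_1,x_2=i_2,x_3=n+1$ and $y_0=0,y_1=\pi_{i_1},y_2=\pi_{i_2},y_3=n+1$, for every $(a,b)\in R$ there is no index $k$ with $x_a<k<x_{a+1}$ and $y_b<\pi_k<y_{b+1}$. $s_{n,k}(p)$ is the number of $\pi\in S_n$ with exactly $k$ occurrences of $p$; $p_1,p_2$ are equidistributed if $s_{n,k}(p_1)=s_{n,k}(p_2)$ for all $n,k\ge 0$. *)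

(* Defs.v *)
From mathcomp Require Import all_boot all_fingroup.

Set Implicit Arguments.
Unset Strict Implicit.
Unset Printing Implicit Defensive.

(* The subset of {0,1,2}^2 with the listed elements. *)
Definition shading (s : seq (nat * nat)) : {set 'I_3 * 'I_3} :=
  [set ab : 'I_3 * 'I_3 | (val ab.1, val ab.2) \in s].

(* Elements of 'I_n are numbered from 0; [pos i] is the position (or value)
   of i in {1, ..., n}. *)
Definition pos (n : nat) (i : 'I_n) : nat := i.+1.

(* The bounds z_0 = 0, z_1 = u, z_2 = v, z_3 = n + 1. *)
Definition bound (n u v a : nat) : nat := nth 0 [:: 0; u; v; n.+1] a.

(* [i] is an occurrence of the mesh pattern (12, R) in [pi]. *)
Definition occurrence (R : {set 'I_3 * 'I_3}) (n : nat) (pi : 'S_n)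
    (i : 'I_n * 'I_n) : bool :=
  let x := bound n (pos i.1) (pos i.2) in
  let y := bound n (pos (pi i.1)) (pos (pi i.2)) in
  [&& pos i.1 < pos i.2, pos (pi i.1) < pos (pi i.2) &
    [forall ab in R, ~~ [exists k : 'I_n,
      (x ab.1 < pos k < x ab.1.+1) && (y ab.2 < pos (pi k) < y ab.2.+1)]]].

Definition occurrences (R : {set 'I_3 * 'I_3}) (n : nat) (pi : 'S_n) : nat :=
  #|[set i | occurrence R pi i]|.

Definition num_perms (R : {set 'I_3 * 'I_3}) (n k : nat) : nat :=
  #|[set pi : 'S_n | occurrences R pi == k]|.

Definition equidistributed (R1 R2 : {set 'I_3 * 'I_3}) : Prop :=
  forall n k : nat, num_perms R1 n k = num_perms R2 n k.

(* Main.v *)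
(* Inverse and reverse-complement identify the first four patterns with each
   other and the last two with each other, so one pattern of each class must be
   compared: D = {11, 21, 00, 10} and F = {12, 22, 00, 10}.  Let c_i be the
   number of l > i with pi_l < pi_i (the Lehmer code).  In both cases i is a
   left-to-right minimum of pi, equivalently a strict left-to-right minimum of
   c; then (i, j) is an occurrence of D iff j is the first later index with
   c_j = c_i and no smaller entry of c intervenes, and an occurrence of F iff j
   is the first later index at which c_j is maximal (c_j = n - 1 - j, counting
   from 0), again with no entry below c_i in between.  Reflecting each c_j that
   is not a strict left-to-right minimum in the interval
   [min_(k < j) c_k, n - 1 - j] exchanges the two conditions, so it maps the
   D-occurrences of pi to the F-occurrences of its image at the same pairs of
   positions. *)
Require Import Defs.
From mathcomp Require Import all_boot all_fingroup.
From mathcomp Require Import zify.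

Set Implicit Arguments.
Unset Strict Implicit.
Unset Printing Implicit Defensive.

(** * Occurrences as inequalities, and transfer along bijections *)

Lemma perm_valE n (pi : 'S_n) (k l : 'I_n) :
  ((pi k : nat) == pi l) = ((k : nat) == l).
Proof. by rewrite !val_eqE (inj_eq perm_inj). Qed.

Lemma occurrence_shadingP s n (pi : 'S_n) (i j : 'I_n) :
  all (fun p : nat * nat => (p.1 < 3) && (p.2 < 3)) s ->
  reflect
    [/\ i < j, pi i < pi j & forall p, p \in s -> forall k : 'I_n,
        ~~ ((bound n i.+1 j.+1 p.1 < k.+1 < bound n i.+1 j.+1 p.1.+1) &&
            (bound n (pi i).+1 (pi j).+1 p.2 < (pi k).+1
               < bound n (pi i).+1 (pi j).+1 p.2.+1))]
    (occurrence (shading s) pi (i, j)).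
Proof.
move=> /allP s3; rewrite /occurrence /pos /= !ltnS; apply: (iffP and3P).
  case=> ij pij /forall_inP boxes; split=> // -[a b] abs k.
  have /andP[/= a3 b3] := s3 _ abs.
  have := boxes (Ordinal a3, Ordinal b3); rewrite inE => /(_ abs).
  by move=> /existsPn.
case=> ij pij boxes; split=> //; apply/forall_inP => ab; rewrite inE => abs.
by apply/existsPn => k; apply: boxes abs k.
Qed.

(** Injectivity suffices: self-maps of finite sets are then bijective. The relabelling [g] of pairs
    may depend on [pi], as taking inverses requires. *)
Lemma num_perms_bij R1 R2 n (f : 'S_n -> 'S_n)
    (g : 'S_n -> 'I_n * 'I_n -> 'I_n * 'I_n) :
  injective f -> (forall pi, injective (g pi)) ->
  (forall pi ij, occurrence R2 (f pi) (g pi ij) = occurrence R1 pi ij) ->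
  forall k, num_perms R1 n k = num_perms R2 n k.
Proof.
move=> f_inj g_inj fgP k.
have occE pi : occurrences R1 pi = occurrences R2 (f pi).
  rewrite /occurrences -[in RHS](card_preimset _ (g_inj pi)).
  by apply: eq_card => ij; rewrite !in_set fgP.
rewrite /num_perms -[in RHS](card_preimset _ f_inj).
by apply: eq_card => pi; rewrite !in_set occE.
Qed.

Lemma equidistributed_sym R1 R2 :
  equidistributed R1 R2 -> equidistributed R2 R1.
Proof. by move=> R12 n k; rewrite R12. Qed.

Lemma equidistributed_trans R2 R1 R3 :
  equidistributed R1 R2 -> equidistributed R2 R3 -> equidistributed R1 R3.
Proof. by move=> R12 R23 n k; rewrite R12. Qed.

(** * Symmetries of the diagram: inverse and reverse-complement *)

(** Inversion transposes the diagram: positions [(i, j)] become [(pi i, pi j)] and box [(a, b)]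
    becomes [(b, a)]. *)
Lemma equidistributed_inv (R1 R2 : {set 'I_3 * 'I_3}) :
  (forall a b, ((b, a) \in R2) = ((a, b) \in R1)) -> equidistributed R1 R2.
Proof.
move=> R12 n; apply: (num_perms_bij (f := invg)
  (g := fun pi ij => (pi ij.1, pi ij.2))) => [|pi [i j] [i' j']|pi [i j]].
- exact: invg_inj.
- by case=> /perm_inj-> /perm_inj->.
rewrite /occurrence /= !permK andbCA; do 2!congr (_ && _).
apply/forall_inP/forall_inP => boxes [a b] abR; apply/existsPn => k /=.
  have := boxes (b, a); rewrite R12 => /(_ abR) /existsPn /(_ (pi k)) /=.
  by rewrite permK andbC.
have := boxes (b, a); rewrite -R12 => /(_ abR) /existsPn /(_ (pi^-1 k)%g) /=.
by rewrite permKV andbC.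
Qed.

Definition rev_perm n : 'S_n := perm rev_ord_inj.

Lemma bound_rev n u v (a : 'I_3) : u <= n.+1 -> v <= n.+1 ->
  bound n (n.+1 - v) (n.+1 - u) (rev_ord a) = n.+1 - bound n u v a.+1 /\
  bound n (n.+1 - v) (n.+1 - u) (rev_ord a).+1 = n.+1 - bound n u v a.
Proof. by case: a => -[|[|[|//]]] ? /= un vn; rewrite /bound /=; split; lia. Qed.

Lemma bound_le n u v a : u <= n.+1 -> v <= n.+1 -> bound n u v a <= n.+1.
Proof. by case: a => [|[|[|[|a]]]] //=; rewrite /bound /= nth_nil. Qed.

Lemma pos_rev n (i : 'I_n) : pos (rev_ord i) = n.+1 - pos i.
Proof. by rewrite /pos /=; have := ltn_ord i; lia. Qed.

(** Conjugation by [rev_perm] is a half-turn of the diagram, so the two points of a pair trade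
    roles, as do the two ends of every box side. *)
Lemma equidistributed_revcomp (R1 R2 : {set 'I_3 * 'I_3}) :
  (forall a b, ((rev_ord a, rev_ord b) \in R2) = ((a, b) \in R1)) ->
  equidistributed R1 R2.
Proof.
move=> R12 n; apply: (num_perms_bij
  (f := fun pi => (rev_perm n * pi * rev_perm n)%g)
  (g := fun=> fun ij => (rev_ord ij.2, rev_ord ij.1)))
  => [pi pi' /mulIg/mulgI//|_ [i j] [i' j']|pi [i j]].
  move=> E; have /= /rev_ord_inj-> := congr1 fst E.
  by have /= /rev_ord_inj-> := congr1 snd E.
have fE k : (rev_perm n * pi * rev_perm n)%g (rev_ord k) = rev_ord (pi k).
  by rewrite !permM !permE rev_ordK.
have pos_le (k : 'I_n) : pos k <= n.+1 by rewrite /pos; have := ltn_ord k; lia.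
rewrite /occurrence /= !fE !pos_rev.
have revlt (k l : 'I_n) : (n.+1 - pos k < n.+1 - pos l) = (pos l < pos k).
  by have := ltn_ord k; have := ltn_ord l; rewrite /pos; lia.
rewrite !revlt; do 2!congr (_ && _).
have box (a b : 'I_3) (k : 'I_n) :
  let x := bound n (n.+1 - pos j) (n.+1 - pos i) in
  let y := bound n (n.+1 - pos (pi j)) (n.+1 - pos (pi i)) in
  let x' := bound n (pos i) (pos j) in
  let y' := bound n (pos (pi i)) (pos (pi j)) in
  (x (rev_ord a) < pos (rev_ord k) < x (rev_ord a).+1) &&
  (y (rev_ord b) < pos (rev_ord (pi k)) < y (rev_ord b).+1) =
  (x' a < pos k < x' a.+1) && (y' b < pos (pi k) < y' b.+1).
  rewrite /=.
  have [-> ->] := bound_rev a (pos_le i) (pos_le j).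
  have [-> ->] := bound_rev b (pos_le (pi i)) (pos_le (pi j)).
  have := bound_le a (pos_le i) (pos_le j).
  have := bound_le a.+1 (pos_le i) (pos_le j).
  have := bound_le b (pos_le (pi i)) (pos_le (pi j)).
  have := bound_le b.+1 (pos_le (pi i)) (pos_le (pi j)).
  rewrite !pos_rev.
  have := pos_le k; have := pos_le (pi k); lia.
apply/forall_inP/forall_inP => boxes [a b] abR; apply/existsPn => k.
  have := boxes (rev_ord a, rev_ord b); rewrite R12 => /(_ abR).
  by move=> /existsPn /(_ (rev_ord k)); rewrite fE box.
have := boxes (rev_ord a, rev_ord b); rewrite -R12 !rev_ordK => /(_ abR).
move=> /existsPn /(_ (rev_ord k)); rewrite -box !rev_ordK.
by rewrite -fE rev_ordK.
Qed.

(** * The Lehmer code and the two occurrence conditions *)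

Section Lehmer.
Variables (n : nat) (pi : 'S_n).
Implicit Types i j k l x : 'I_n.

Definition lehmer i : nat := #|[set l : 'I_n | (i < l) && (pi l < pi i)]|.

Lemma lehmer_lt i k : i < k -> pi k < pi i -> lehmer k < lehmer i.
Proof.
move=> ik pki; apply/proper_card/properP; split.
  by apply/subsetP => l; rewrite !inE; lia.
by exists k; rewrite !inE ?ltnn // ik.
Qed.

(** Split the later values below [pi x] at [pi i]. Those under [pi i] are exactly the ones counted
    by [lehmer i], since no position in (i, x] holds such a value. *)
Lemma lehmer_between i x : i < x ->
  (forall k, i < k <= x -> pi i < pi k) ->
  lehmer x = lehmer i + #|[set l : 'I_n | (x < l) && (pi i < pi l < pi x)]|.
Proof.
move=> ix above; rewrite /lehmer -(cardsID [set l : 'I_n | pi l < pi i]).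
congr (_ + _); apply: eq_card => l; rewrite !inE.
  have := above x; case: (ltnP i l) => [il|]; last by lia.
  by have := above l; rewrite il /=; lia.
have := perm_valE pi l i; lia.
Qed.

Lemma lehmer_lrmin i :
  (forall k, k < i -> pi i < pi k) <-> (forall k, k < i -> lehmer i < lehmer k).
Proof.
split=> [pi_min k ki | c_min k0 k0i].
  exact: lehmer_lt (pi_min _ ki).
rewrite ltnNge; apply/negP => pk0i.
(* The least value before [i] is below [pi i] and below everything between, so [lehmer_between]
   gives [lehmer k <= lehmer i]. *)
have [k ki k_min] :=
  @arg_minnP _ k0 (fun k : 'I_n => k < i) (fun k => pi k : nat) k0i.
have := c_min k ki; rewrite (@lehmer_between k i) //; first by lia.
move=> l kl; have := perm_valE pi l k; have := perm_valE pi k0 i.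
have := k_min k0 k0i; have := k_min l.
case: (ltngtP l i) => [|| /val_inj ->]; lia.
Qed.

Lemma card_gt_ord x : #|[set l : 'I_n | x < l]| = n - x.+1.
Proof.
have -> : [set l : 'I_n | x < l] = ~: [set l : 'I_n | l < x.+1].
  by apply/setP => l; rewrite !inE; lia.
rewrite cardsCs setCK card_ord; congr (_ - _).
rewrite -sum1_card (eq_bigl (fun l : 'I_n => l < x.+1)); last first.
  by move=> l; rewrite inE.
by rewrite -(big_ord_widen n (fun=> 1)) // sum1_card card_ord.
Qed.

Lemma lehmer_le x : lehmer x <= n - x.+1.
Proof.
by rewrite -card_gt_ord; apply/subset_leq_card/subsetP => l; rewrite !inE => /andP[].
Qed.

Lemma lehmer_rlmax x :
  lehmer x = n - x.+1 <-> (forall k, x < k -> pi k < pi x).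
Proof.
have sub : [set l : 'I_n | (x < l) && (pi l < pi x)] \subset [set l : 'I_n | x < l].
  by apply/subsetP => l; rewrite !inE => /andP[].
rewrite -card_gt_ord; split=> [cE k xk | x_max].
  have /setP/(_ k) : [set l : 'I_n | (x < l) && (pi l < pi x)] = [set l : 'I_n | x < l].
    by apply/eqP; rewrite eqEcard sub -cE leqnn.
  by rewrite !inE xk.
by apply: eq_card => l; rewrite !inE; have := x_max l; lia.
Qed.

(** While values stay above [pi i], the excess of [lehmer k] over [lehmer i] counts later values
    between [pi i] and [pi k]. For [k] before [j] the value [pi j] is one of them; at [j] there are
    none. *)
Lemma lehmer_first_repeat i j : i < j ->
  ([/\ pi i < pi j, forall k, k < j -> k != i -> pi i < pi k &
       forall k, i < k -> ~~ (pi i < pi k < pi j)] <->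
   [/\ forall k, k < i -> lehmer i < lehmer k,
       forall k, i < k < j -> lehmer i < lehmer k & lehmer j = lehmer i]).
Proof.
move=> ij; split.
  case=> pij pimin none.
  have above k : i < k <= j -> pi i < pi k.
    case: (ltngtP k j) => [kj ik| |/val_inj-> //]; last by lia.
    by apply: pimin => //; rewrite -val_eqE /=; lia.
  split=> [|k /andP[ik kj]|].
  - apply/lehmer_lrmin => k ki; apply: pimin; first by lia.
    by rewrite -val_eqE /=; lia.
  - rewrite (@lehmer_between i k) // => [|l ?]; last by apply: above; lia.
    suff : 0 < #|[set l : 'I_n | (k < l) && (pi i < pi l < pi k)]| by lia.
    apply/card_gt0P; exists j; rewrite !inE kj pij /=.
    have := none k ik; have := above k; have := perm_valE pi k j; lia.
  - rewrite (@lehmer_between i j) // (_ : [set l : 'I_n | _] = set0) ?cards0 ?addn0 //.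
    by apply/setP => l; rewrite !inE; have := none l; lia.
case=> /lehmer_lrmin imin cgt cij.
have above k : i < k <= j -> pi i < pi k.
  move=> ikj; rewrite ltnNge; apply/negP => pki.
  have : lehmer k < lehmer i.
    by apply: lehmer_lt; have := perm_valE pi k i; lia.
  case: (ltngtP k j) => [kj| |/val_inj ->]; [|lia|by rewrite cij ltnn].
  have := cgt k; lia.
have pij : pi i < pi j by apply: above; lia.
have after l : j < l -> ~~ (pi i < pi l < pi j).
  move=> jl; apply/negP => pl; move: cij; rewrite (@lehmer_between i j) //.
  suff : 0 < #|[set l : 'I_n | (j < l) && (pi i < pi l < pi j)]| by lia.
  by apply/card_gt0P; exists l; rewrite inE jl.
have inside k0 : i < k0 < j -> pi j < pi k0.
  move=> k0P; rewrite ltnNge; apply/negP => pk0j.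
  (* Take the least value strictly between the two positions. Its excess over [lehmer i] yields a
     later, smaller value above [pi i]: before [j] this contradicts minimality, at [j] it
     contradicts [pkj], and after [j] it contradicts [after]. *)
  have [k kP k_min] :=
    @arg_minnP _ k0 (fun k : 'I_n => i < k < j) (fun k => pi k : nat) k0P.
  have := cgt k kP; rewrite (@lehmer_between i k); [|lia|]; last first.
    by move=> l lP; apply: above; lia.
  rewrite -[X in X < _]addn0 ltn_add2l => /card_gt0P[l]; rewrite inE => lP.
  have pkj : pi k < pi j.
    by have := k_min _ k0P; have := perm_valE pi k0 j; lia.
  have := after l; have := k_min l.
  case: (ltngtP l j) => [|| /val_inj lj]; try lia.
  by move: lP; rewrite lj; lia.
split=> // k.
  move=> kj; rewrite -val_eqE /= => ki; case: (ltngtP k i) ki => // [ki|ik] _.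
    exact: imin.
  by apply: above; lia.
move=> ik; case: (ltngtP k j) => [kj|jk|/val_inj->]; [|exact: after|lia].
by have := inside k; lia.
Qed.

(** By [lehmer_rlmax] a maximal entry marks a right-to-left maximum, so [j] is the first one after
    [i]. *)
Lemma lehmer_first_maximal i j : i < j ->
  ([/\ pi i < pi j, forall k, k < j -> k != i -> pi i < pi k &
       forall k, i < k -> pi k <= pi j] <->
   [/\ forall k, k < i -> lehmer i < lehmer k,
       forall k, i < k < j -> lehmer i <= lehmer k < n - k.+1,
       lehmer j = n - j.+1 & lehmer i <= lehmer j]).
Proof.
move=> ij; split.
  case=> pij pimin jmax.
  have above k : i < k <= j -> pi i < pi k.
    case: (ltngtP k j) => [kj ik| |/val_inj-> //]; last by lia.
    by apply: pimin => //; rewrite -val_eqE /=; lia.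
  have cle k : i < k <= j -> lehmer i <= lehmer k.
    move=> ikj; rewrite (@lehmer_between i k) ?leq_addr //; first by lia.
    by move=> l ?; apply: above; lia.
  split=> [|k /andP[ik kj]||].
  - apply/lehmer_lrmin => k ki; apply: pimin; first by lia.
    by rewrite -val_eqE /=; lia.
  - rewrite cle; last by lia.
    rewrite ltn_neqAle lehmer_le andbT; apply/eqP => /lehmer_rlmax/(_ j kj).
    by have := jmax k ik; lia.
  - apply/lehmer_rlmax => k jk; have := jmax k; have := perm_valE pi k j; lia.
  - by apply: cle; lia.
case=> /lehmer_lrmin imin cP /lehmer_rlmax jmax cij.
have above k : i < k <= j -> pi i < pi k.
  move=> ikj; rewrite ltnNge; apply/negP => pki.
  have : lehmer k < lehmer i.
    by apply: lehmer_lt; have := perm_valE pi k i; lia.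
  case: (ltngtP k j) => [kj| |/val_inj ->]; [|lia|by lia].
  have := cP k; lia.
have inside k0 : i < k0 < j -> pi k0 <= pi j.
  move=> k0P; rewrite leqNgt; apply/negP => pk0j.
  (* If the largest value strictly between exceeded [pi j], it would also exceed everything from [j]
     on and be an earlier right-to-left maximum. *)
  have [k kP k_max] :=
    @arg_maxnP _ k0 (fun k : 'I_n => i < k < j) (fun k => pi k : nat) k0P.
  have /andP[_ ck] := cP k kP.
  suff /lehmer_rlmax : forall l, k < l -> pi l < pi k by lia.
  have pjk : pi j < pi k by have := k_max _ k0P; lia.
  move=> l kl; have := k_max l; have := perm_valE pi k l; have := jmax l.
  by case: (ltngtP l j) => [|| /val_inj ->]; lia.
split=> [|k|k ik]; first by apply: above; lia.
  move=> kj; rewrite -val_eqE /= => ki; case: (ltngtP k i) ki => // [ki|ik] _.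
    exact: imin.
  by apply: above; lia.
case: (ltngtP k j) => [kj|jk|/val_inj-> //]; last by rewrite ltnW // jmax.
by apply: inside; lia.
Qed.

End Lehmer.

(** * The Lehmer code as a bijection onto bounded sequences *)

Lemma lehmer_inj n (pi sigma : 'S_n) : lehmer pi =1 lehmer sigma -> pi = sigma.
Proof.
have half (s t : 'S_n) (i : 'I_n) :
    (forall k : 'I_n, k < i -> s k = t k) -> s i < t i -> lehmer s i < lehmer t i.
  (* Later positions are not comparable between [s] and [t], so values are counted instead; [s i] is
     the one that makes the inclusion strict. *)
  move=> st sti; rewrite /lehmer -(card_imset _ (@perm_inj _ s)).
  rewrite -[X in _ < X](card_imset _ (@perm_inj _ t)).
  have later (l : 'I_n) : i <= l -> s l < t i ->
      s l \in t @: [set l0 : 'I_n | (i < l0) && (t l0 < t i)].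
    move=> il sl; apply/imsetP; exists ((t^-1)%g (s l)); last by rewrite permKV.
    rewrite inE permKV sl andbT.
    case: (ltngtP i ((t^-1)%g (s l))) => // [lt_i|/val_inj tiE].
      have := st _ lt_i; rewrite permKV => /perm_inj lE.
      by rewrite lE in lt_i; lia.
    by move: sl; rewrite tiE permKV ltnn.
  apply/proper_card/properP; split.
    apply/subsetP => v /imsetP[l]; rewrite inE => /andP[il sl] ->.
    by apply: later; lia.
  exists (s i); first exact: later.
  by apply/negP => /imsetP[l]; rewrite inE => lP /perm_inj lE; move: lP; rewrite lE; lia.
move=> ceq; apply/permP => i; have [m] := ubnP i.
elim: m i => // m IH i im.
have agree (k : 'I_n) : k < i -> pi k = sigma k by move=> ki; apply: IH; lia.
apply/val_inj; case: (ltngtP (pi i) (sigma i)) => // lt_i.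
  by have := half _ _ _ agree lt_i; rewrite ceq ltnn.
have := half _ _ i (fun k ki => esym (agree k ki)) lt_i.
by rewrite ceq ltnn.
Qed.

(** Existence by counting: there are n! admissible codes, and the code map is injective on n!
    permutations. *)
Lemma lehmer_surj n (c : 'I_n -> nat) :
  (forall i, c i <= n - i.+1) -> exists pi : 'S_n, lehmer pi =1 c.
Proof.
move=> c_le.
pose F (i : 'I_n) : pred 'I_n := fun x => x < n - i.
have lehmer_ltn (s : 'S_n) (i : 'I_n) : lehmer s i < n.
  by have := lehmer_le s i; have := ltn_ord i; lia.
pose L (s : 'S_n) : {ffun 'I_n -> 'I_n} := [ffun i => Ordinal (lehmer_ltn s i)].
have L_inj : injective L.
  move=> s t /ffunP st; apply: lehmer_inj => i.
  by have := congr1 val (st i); rewrite !ffunE.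
have imL : [set L s | s : 'S_n] = [set f in family F].
  apply/eqP; rewrite eqEcard card_imset // card_Sn; apply/andP; split.
    apply/subsetP => _ /imsetP[s _ ->]; rewrite inE; apply/familyP => i.
    rewrite ffunE /F unfold_in /=; have := lehmer_le s i; have := ltn_ord i; lia.
  (* The family has the product of the [n - i] as its size; reversing the index turns this into the
     factorial. *)
  rewrite cardsE card_family foldrE big_map big_enum /= fact_prod big_add1.
  rewrite big_mkord (reindex_inj rev_ord_inj) /=.
  apply/eq_leq/eq_bigr => i _; rewrite /F -sum1_card.
  rewrite -(big_ord_widen n (fun=> 1)) ?sum1_card ?card_ord; last exact: leq_subr.
  by rewrite /=; have := ltn_ord i; lia.
have c_ltn i : c i < n by have := c_le i; have := ltn_ord i; lia.
have : [ffun i => Ordinal (c_ltn i)] \in [set f in family F].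
  rewrite inE; apply/familyP => i; rewrite ffunE /F unfold_in /=.
  by have := c_le i; have := ltn_ord i; lia.
rewrite -imL => /imsetP[s _ /ffunP sE]; exists s => i.
by have := congr1 val (sE i); rewrite !ffunE.
Qed.

(** * Reflecting codes between their prefix minima and upper bounds *)

Section Reflection.
Variable n : nat.
Implicit Types (c d : 'I_n -> nat) (i j k : 'I_n).

(* At the first index the empty minimum is [n], which exceeds every entry of a
   code, so [c j < prefix_min c j] says that [j] is a strict left-to-right
   minimum of [c]. *)
Definition prefix_min c j := \big[minn/n]_(k < n | k < j) c k.

Definition reflect_code c j : nat :=
  if c j < prefix_min c j then c j else prefix_min c j + (n - j.+1) - c j.

Lemma leq_prefix_min c j x :
  reflect (x <= n /\ forall k, k < j -> x <= c k) (x <= prefix_min c j).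
Proof.
apply: (iffP idP) => [|[xn xc]].
  move=> xm; suff [mn mc] : prefix_min c j <= n /\
      forall k, k < j -> prefix_min c j <= c k.
    by split=> [|k kj]; [|have := mc k kj]; lia.
  split; first by rewrite /prefix_min; elim/big_rec: _ => // k m _; lia.
  move=> k kj; rewrite /prefix_min.
  elim: (index_enum _) (mem_index_enum k) => //= l r IH.
  rewrite inE big_cons => /predU1P[<-|/IH ck]; first by rewrite kj geq_minl.
  by case: ifP => // _; rewrite geq_min ck orbT.
by rewrite /prefix_min; elim/big_rec: _ => // k m kj; have := xc k kj; lia.
Qed.

Lemma prefix_min_le c k j : k < j -> prefix_min c j <= c k.
Proof. by move=> kj; have /leq_prefix_min[_] := leqnn (prefix_min c j); apply. Qed.

Definition is_code c := forall i, c i <= n - i.+1.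

Lemma reflect_code_le c : is_code c -> is_code (reflect_code c).
Proof. by move=> cP i; rewrite /reflect_code; have := cP i; case: ltnP; lia. Qed.

(** Strict left-to-right minima are fixed, and every other entry stays at or above the minimum
    before it. *)
Lemma prefix_min_reflect c : is_code c ->
  prefix_min (reflect_code c) =1 prefix_min c.
Proof.
move=> cP j; apply/eqP; rewrite eqn_leq; apply/andP; split; apply/leq_prefix_min.
  have /leq_prefix_min[mn mc] := leqnn (prefix_min (reflect_code c) j).
  (* Strong induction on [k]: an entry that is reflected lies above its own prefix minimum, which
     earlier indices already bound. *)
  split=> // k; have [m] := ubnP k; elim: m k => // m IH k km kj.
  have := mc k kj; rewrite {2}/reflect_code; case: ltnP => // ck _.
  apply: leq_trans ck; apply/leq_prefix_min; split=> // l lk.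
  by apply: IH; lia.
have /leq_prefix_min[mn mc] := leqnn (prefix_min c j).
split=> // k kj; have mk : prefix_min c j <= prefix_min c k.
  by apply/leq_prefix_min; split=> // l lk; apply: mc; lia.
by rewrite /reflect_code; have := mc k kj; have := cP k; case: ltnP; lia.
Qed.

(** The image determines the prefix minima, and these determine how to undo each reflection. *)
Lemma reflect_code_inj c d : is_code c -> is_code d ->
  reflect_code c =1 reflect_code d -> c =1 d.
Proof.
move=> cP dP cd j; have : prefix_min c j = prefix_min d j.
  rewrite -prefix_min_reflect // -[RHS]prefix_min_reflect //.
  by apply: eq_bigr => k _; rewrite cd.
have := cd j; rewrite /reflect_code; have := cP j; have := dP j.
by case: (ltnP (c j)); case: (ltnP (d j)); lia.
Qed.

Lemma reflect_code_lrmin c j : is_code c ->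
  (forall k, k < j -> c j < c k) <->
  (forall k, k < j -> reflect_code c j < reflect_code c k).
Proof.
move=> cP; have lrminE d : is_code d ->
    (forall k, k < j -> d j < d k) <-> d j < prefix_min d j.
  move=> dP; split=> [jmin|/leq_prefix_min[]//]; apply/leq_prefix_min.
  by split=> //; have := dP j; have := ltn_ord j; lia.
rewrite !lrminE //; last exact: reflect_code_le.
rewrite prefix_min_reflect // /reflect_code; have := cP j.
by case: ltnP; lia.
Qed.

(** Under either condition the prefix minimum is constantly [c i] on (i, j]. Each entry there is
    thus reflected in the interval from [c i] to [n - k.+1], which swaps equality with the lower end
    and equality with the upper end. *)
Lemma reflect_code_repeat c i j : is_code c -> i < j ->
  let d := reflect_code c in
  [/\ forall k, k < i -> c i < c k, forall k, i < k < j -> c i < c k &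
      c j = c i] <->
  [/\ forall k, k < i -> d i < d k, forall k, i < k < j -> d i <= d k < n - k.+1,
      d j = n - j.+1 & d i <= d j].
Proof.
move=> cP ij d.
have dP : is_code d by exact: reflect_code_le.
have in_n : c i < n by have := cP i; have := ltn_ord i; lia.
have dE : (forall k, k < i -> c i < c k) -> d i = c i.
  move=> imin; rewrite /d /reflect_code (_ : c i < _) //.
  exact/leq_prefix_min.
split.
  case=> imin cgt cij; have diE := dE imin.
  have mE k : i < k <= j -> prefix_min c k = c i.
    move=> ikj; apply/eqP; rewrite eqn_leq prefix_min_le ?andTb; last by lia.
    apply/leq_prefix_min; split=> [|l lk]; first by lia.
    case: (ltngtP l i) => [li|il|/val_inj-> //]; first by have := imin l li; lia.
    by have := cgt l; lia.
  have djE : d j = n - j.+1.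
    rewrite /d /reflect_code mE; last by lia.
    by rewrite cij ltnn; lia.
  split=> [|k kP||] //; first exact/(reflect_code_lrmin i cP).
  - rewrite diE /d /reflect_code mE; last by lia.
    by have := cgt k kP; have := cP k; case: (ltnP (c k)); lia.
  - by rewrite diE djE -cij cP.
case=> /(reflect_code_lrmin i cP) imin dk dj dij; have diE := dE imin.
have mE k : i < k <= j -> prefix_min c k = c i.
  move=> ikj; apply/eqP; rewrite eqn_leq prefix_min_le ?andTb; last by lia.
  (* Here the bounds are known only for [d], whose prefix minima agree with those of [c]. *)
  rewrite -prefix_min_reflect //; apply/leq_prefix_min.
  split=> [|l lk]; first by lia.
  case: (ltngtP l i) => [li|il|/val_inj->]; last by rewrite -/d diE.
    have /reflect_code_lrmin := imin => /(_ cP l li); rewrite -/d diE; lia.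
  by have := dk l; rewrite -diE /d; lia.
split=> // [k kP|].
  have := dk k kP; rewrite diE /d /reflect_code mE; last by lia.
  by have := cP k; case: (ltnP (c k)); lia.
move: dj dij; rewrite diE /d /reflect_code mE; last by lia.
by have := cP j; have := ltn_ord j; case: (ltnP (c j)); lia.
Qed.

End Reflection.

(** * Comparison of the two classes and conclusion *)

(** Boxes (0,0) and (1,0) make [pi i] the minimum of the values before [j]; boxes (1,1) and (2,1)
    exclude intermediate values to the right of [i]. *)
Lemma shading_repeatP n (pi : 'S_n) (i j : 'I_n) :
  reflect (i < j /\
    [/\ pi i < pi j, forall k : 'I_n, k < j -> k != i -> pi i < pi k &
        forall k : 'I_n, i < k -> ~~ (pi i < pi k < pi j)])
    (occurrence (shading [:: (1, 1); (2, 1); (0, 0); (1, 0)]) pi (i, j)).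
Proof.
apply: (iffP (occurrence_shadingP _ _ _ _)) => //.
  case=> ij pij boxes; split=> //.
  have b11 := boxes (1, 1) isT; have b21 := boxes (2, 1) isT.
  have b00 := boxes (0, 0) isT; have b10 := boxes (1, 0) isT.
  rewrite /bound /= in b11 b21 b00 b10.
  split=> // [k kj|k ik].
    rewrite -val_eqE /= => ki; have := b00 k; have := b10 k.
    by have := perm_valE pi k i; lia.
  have := b11 k; have := b21 k; have := perm_valE pi k j; have := ltn_ord k; lia.
case=> ij [pij pimin none]; split=> // p; rewrite !inE.
by case/or4P => /eqP-> k; have := pimin k; have := none k;
  rewrite -val_eqE /bound /=; lia.
Qed.

(** The lower boxes act as for the other pattern; boxes (1,2) and (2,2) exclude values above [pi j]
    to the right of [i]. *)
Lemma shading_maximalP n (pi : 'S_n) (i j : 'I_n) :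
  reflect (i < j /\
    [/\ pi i < pi j, forall k : 'I_n, k < j -> k != i -> pi i < pi k &
        forall k : 'I_n, i < k -> pi k <= pi j])
    (occurrence (shading [:: (1, 2); (2, 2); (0, 0); (1, 0)]) pi (i, j)).
Proof.
apply: (iffP (occurrence_shadingP _ _ _ _)) => //.
  case=> ij pij boxes; split=> //.
  have b12 := boxes (1, 2) isT; have b22 := boxes (2, 2) isT.
  have b00 := boxes (0, 0) isT; have b10 := boxes (1, 0) isT.
  rewrite /bound /= in b12 b22 b00 b10.
  split=> // [k kj|k ik].
    rewrite -val_eqE /= => ki; have := b00 k; have := b10 k.
    by have := perm_valE pi k i; lia.
  have := b12 k; have := b22 k; have := perm_valE pi k j; have := ltn_ord k.
  by have := ltn_ord (pi k); lia.
case=> ij [pij pimin jmax]; split=> // p; rewrite !inE.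
by case/or4P => /eqP-> k; have := pimin k; have := jmax k;
  rewrite -val_eqE /bound /=; lia.
Qed.

Lemma equidistributed_repeat_maximal :
  equidistributed (shading [:: (1, 1); (2, 1); (0, 0); (1, 0)])
                  (shading [:: (1, 2); (2, 2); (0, 0); (1, 0)]).
Proof.
move=> n.
have lehmerP (pi : 'S_n) : is_code (lehmer pi) by exact: lehmer_le.
(* [f] is the reflection transported to permutations through the Lehmer code. It keeps the pairs of
   positions, hence [g] is the identity. *)
have /fin_all_exists[f fE] (pi : 'S_n) :
    exists s : 'S_n, lehmer s =1 reflect_code (lehmer pi).
  by apply: lehmer_surj; exact: reflect_code_le.
apply: (num_perms_bij (f := f) (g := fun=> id))
  => [s t st|_ ij ij' //|pi [i j] /=].
  apply: lehmer_inj; apply: reflect_code_inj => // i.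
  by rewrite -!fE st.
apply/shading_maximalP/shading_repeatP => -[ij occ]; split=> //.
  apply/(lehmer_first_repeat _ ij)/(reflect_code_repeat (lehmerP pi) ij).
  case: (iffLR (lehmer_first_maximal _ ij) occ) => imin ck cj cij.
  by split=> [k|k||]; rewrite -!fE; auto.
case: (iffLR (reflect_code_repeat (lehmerP pi) ij)
             (iffLR (lehmer_first_repeat _ ij) occ)) => imin ck cj cij.
apply/(lehmer_first_maximal _ ij).
by split=> [k|k||]; rewrite !fE; auto.
Qed.

Theorem theorem6p2 (R1 R2 : {set 'I_3 * 'I_3}) :
  let Rs := [:: shading [:: (1, 2); (2, 2); (0, 1); (1, 1)];
                shading [:: (1, 2); (0, 1); (1, 1); (0, 0)];
                shading [:: (2, 2); (1, 1); (2, 1); (1, 0)];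
                shading [:: (1, 1); (2, 1); (0, 0); (1, 0)];
                shading [:: (2, 2); (0, 1); (2, 1); (0, 0)];
                shading [:: (1, 2); (2, 2); (0, 0); (1, 0)]] in
  R1 \in Rs -> R2 \in Rs -> equidistributed R1 R2.
Proof.
move=> Rs.
pose D := shading [:: (1, 1); (2, 1); (0, 0); (1, 0)].
suff to_D R : R \in Rs -> equidistributed R D.
  move=> /to_D R1D /to_D R2D.
  exact: equidistributed_trans R1D (equidistributed_sym R2D).
have BD : equidistributed (shading [:: (1, 2); (0, 1); (1, 1); (0, 0)]) D.
  by apply: equidistributed_inv => -[[|[|[|//]]] ?] [[|[|[|//]]] ?]; rewrite !inE.
have FD := equidistributed_sym equidistributed_repeat_maximal.
(* A half-turn takes the first pattern to [D] and the third to the second; transposition takes the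
   fifth to the sixth. The other three are closed by [BD], reflexivity and [FD]. *)
rewrite !inE => /or4P[/eqP->|/eqP->|/eqP->|/or3P[] /eqP->] //.
- by apply: equidistributed_revcomp => -[[|[|[|//]]] ?] [[|[|[|//]]] ?]; rewrite !inE.
- apply: equidistributed_trans BD.
  by apply: equidistributed_revcomp => -[[|[|[|//]]] ?] [[|[|[|//]]] ?]; rewrite !inE.
- apply: equidistributed_trans FD.
  by apply: equidistributed_inv => -[[|[|[|//]]] ?] [[|[|[|//]]] ?]; rewrite !inE.
Qed.
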